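(* Let $A_1,\ldots,A_m\in\mathbb{M}_d$. Then there exists a unitary matrix $V\in\mathbb{M}_d$ such that $$\left|\sum_{k=1}^m A_k\right|\le\frac{1}{2}\sum_{k=1}^m\left(|A_k|_{\vee}+V|A_k|_{\vee}V^*\right).$$
   Context: $d,m\ge 1$ are integers and $\mathbb{M}_d$ is the space of complex $d\times d$ matrices; $\le$ between Hermitian matrices is the Loewner order. For $A\in\mathbb{M}_d$, $|A|=(A^*A)^{1/2}$, so $|A^*|=(AA^* )^{1/2}$. The maximal modulus of $A$ is the positive semidefinite matrix defined by Kato's formula $$|A|_{\vee}:=\lim_{n\to\infty}\left(|A|^n+|A^*|^n\right)^{1/n}$$ (the limit exists; it is the supremum of $|A|$ and $|A^*|$ in Olson's spectral order). *)

(* Defs.v *)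
From mathcomp Require Import all_boot all_order all_algebra.
From mathcomp Require Import all_classical all_reals all_analysis.
From mathcomp Require Export complex.

Set Implicit Arguments.
Unset Strict Implicit.
Unset Printing Implicit Defensive.

Import Order.TTheory GRing.Theory Num.Theory.
Import numFieldNormedType.Exports.

Local Open Scope ring_scope.
Local Open Scope classical_set_scope.
Local Open Scope sesquilinear_scope.

Section MatrixFunctions.
Context {C : numClosedFieldType} {d : nat}.
Implicit Types A B : 'M[C]_d.

Definition psdmx A :=
  A \is hermsymmx /\ forall x : 'cV[C]_d, 0 <= (x^t* *m A *m x) 0 0.

Definition loewner_le A B := psdmx (B - A).

(* Functional calculus through the spectral decomposition; for a normal A the
   value does not depend on the decomposition chosen by spectralmx. *)
Definition spectral_fun (f : C -> C) A : 'M[C]_d :=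
  invmx (spectralmx A) *m diag_mx (map_mx f (spectral_diag A)) *m spectralmx A.

(* A^(1/n) for A positive semidefinite and n > 0: on nonnegative numbers,
   n.-root is the nonnegative n-th root. *)
Definition mxroot (n : nat) A : 'M[C]_d := spectral_fun n.-root A.

Definition absmx A : 'M[C]_d := mxroot 2 (A^t* *m A).

Definition kato_seq A (n : nat) : 'M[C]_d :=
  mxroot n (absmx A ^+ n + absmx (A^t*) ^+ n).

End MatrixFunctions.

(* R[i]^o is R[i] with the topology of the modulus; matrices carry the
   entrywise topology, i.e., the usual one. *)
Definition maximal_modulus (R : realType) (d : nat) (A : 'M[R[i]]_d) :
    'M[R[i]]_d :=
  lim ((kato_seq A : nat -> 'M[R[i]^o]_d) @ \oo).

(* Main.v *)
(* Let [P = |A|], [Q = |A^*|] and [C_n = ((P^n + Q^n) / 2)^(1/n)].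

   Convergence of Kato's sequence. Let [Y > 0] and let [Z_0, Z_1, ...] be
   Hermitian matrices with [Z_0 <= 1] such that all the block matrices
   [[Z_j, -Z_{j+1}], [-Z_{j+1}, Z_{j+2}]] are positive.  If [Z_m <= Y^m], then
   [Z_j <= Y^j] for all [j <= m]: the top generalized eigenvalues of the pairs
   [(Z_j, Y^j)] form a convex sequence.  For [Z_j = X^j] this says that
   [n]-th roots are operator monotone (hence unique); for
   [Z_j = (P^j + Q^j) / 2] and [Y] close to [C_m] it then gives [C_j <= C_m].
   So [C_n] is increasing and bounded, hence it converges, and
   [(P^n + Q^n)^(1/n) = 2^(1/n) C_n] has the same limit [|A|_v].  Taking roots
   in [P^n <= P^n + Q^n] gives [|A| <= |A|_v], and likewise [|A^*| <= |A|_v].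

   Inequality. By the polar decomposition [A = U |A|], the block matrix
   [[|A^*|, A], [A^*, |A|]] is positive, hence so is [[S, T], [T^*, S]] for
   [T = \sum_k A_k] and [S = \sum_k |A_k|_v].  Testing it on [(-U x, x)], where
   [T = U |T|], yields [2 |T| <= S + U^* S U], and [V = U^*] works. *)

Require Import Defs.
From mathcomp Require Import all_boot all_order all_algebra all_reals.
From mathcomp Require Import ring all_classical all_analysis.

Set Implicit Arguments.
Unset Strict Implicit.
Unset Printing Implicit Defensive.

Import Order.TTheory GRing.Theory Num.Theory.
Import numFieldNormedType.Exports.

Local Open Scope ring_scope.
Local Open Scope classical_set_scope.
Local Open Scope sesquilinear_scope.

(** * Sesquilinear forms attached to complex matrices *)

Section Sesquilinear.
Context {C : numClosedFieldType}.

Lemma adjmxM m n p (A : 'M[C]_(m, n)) (B : 'M[C]_(n, p)) :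
  (A *m B)^t* = B^t* *m A^t*.
Proof. by rewrite trmx_mul map_mxM. Qed.

Lemma adjmxD m n (A B : 'M[C]_(m, n)) : (A + B)^t* = A^t* + B^t*.
Proof. by apply/matrixP => i j; rewrite !mxE rmorphD. Qed.

Lemma adjmxN m n (A : 'M[C]_(m, n)) : (- A)^t* = - A^t*.
Proof. by apply/matrixP => i j; rewrite !mxE rmorphN. Qed.

Lemma adjmxZ m n (a : C) (A : 'M[C]_(m, n)) : (a *: A)^t* = a^* *: A^t*.
Proof. by apply/matrixP => i j; rewrite !mxE rmorphM. Qed.

Lemma adjmx1 n : (1%:M : 'M[C]_n)^t* = 1%:M.
Proof. by rewrite trmx1 map_mx1. Qed.

Lemma hermsymmxP n (A : 'M[C]_n) : (A \is hermsymmx) <-> (A^t* = A).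
Proof.
split=> [/is_hermitianmxP|AE]; first by rewrite expr0 scale1r => /esym.
by apply/is_hermitianmxP; rewrite expr0 scale1r AE.
Qed.

Definition sform m n (A : 'M[C]_(m, n)) (x : 'cV[C]_m) (y : 'cV[C]_n) : C :=
  (x^t* *m A *m y) 0 0.

Section Rectangular.
Variables (m n : nat).
Implicit Types (A B : 'M[C]_(m, n)) (x : 'cV[C]_m) (y : 'cV[C]_n).

Lemma sformDm A B x y : sform (A + B) x y = sform A x y + sform B x y.
Proof. by rewrite /sform mulmxDr mulmxDl mxE. Qed.

Lemma sformNm A x y : sform (- A) x y = - sform A x y.
Proof. by rewrite /sform mulmxN mulNmx mxE. Qed.

Lemma sformZm a A x y : sform (a *: A) x y = a * sform A x y.
Proof. by rewrite /sform -scalemxAr -scalemxAl mxE. Qed.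

Lemma sformDl A x1 x2 y : sform A (x1 + x2) y = sform A x1 y + sform A x2 y.
Proof. by rewrite /sform adjmxD !mulmxDl mxE. Qed.

Lemma sformNl A x y : sform A (- x) y = - sform A x y.
Proof. by rewrite /sform adjmxN !mulNmx mxE. Qed.

Lemma sformZl A a x y : sform A (a *: x) y = a^* * sform A x y.
Proof. by rewrite /sform adjmxZ -!scalemxAl mxE. Qed.

Lemma sformDr A x y1 y2 : sform A x (y1 + y2) = sform A x y1 + sform A x y2.
Proof. by rewrite /sform mulmxDr mxE. Qed.

Lemma sformNr A x y : sform A x (- y) = - sform A x y.
Proof. by rewrite /sform mulmxN mxE. Qed.

Lemma sformZr A a x y : sform A x (a *: y) = a * sform A x y.
Proof. by rewrite /sform -scalemxAr mxE. Qed.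

Lemma conj_sform A x y : (sform A x y)^* = sform (A^t*) y x.
Proof.
rewrite /sform; have -> : y^t* *m A^t* *m x = (x^t* *m A *m y)^t*.
  by rewrite !adjmxM trmxCK mulmxA.
by rewrite [RHS]mxE [in RHS]mxE.
Qed.

Lemma sform_delta A i j : sform A (delta_mx i 0) (delta_mx j 0) = A i j.
Proof.
rewrite /sform trmx_delta map_delta_mx -rowE -colE.
by rewrite !mxE.
Qed.

Lemma sform_eq0 A : (forall x y, sform A x y = 0) -> A = 0.
Proof. by move=> A0; apply/matrixP => i j; rewrite -sform_delta A0 mxE. Qed.

End Rectangular.

Lemma sform_mull m n p (B : 'M[C]_(m, p)) (A : 'M[C]_(m, n)) x y :
  sform A (B *m x) y = sform (B^t* *m A) x y.
Proof. by rewrite /sform adjmxM !mulmxA. Qed.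

Lemma sform_mulr m n p (A : 'M[C]_(m, n)) (B : 'M[C]_(n, p)) x y :
  sform A x (B *m y) = sform (A *m B) x y.
Proof. by rewrite /sform !mulmxA. Qed.

Lemma sform_gram m n (A : 'M[C]_(m, n)) x :
  sform (A^t* *m A) x x = sform 1%:M (A *m x) (A *m x).
Proof. by rewrite sform_mull sform_mulr mulmx1. Qed.

Lemma sform_sum m n I (r : seq I) (P : pred I) (F : I -> 'M[C]_(m, n)) x y :
  sform (\sum_(i <- r | P i) F i) x y = \sum_(i <- r | P i) sform (F i) x y.
Proof. by rewrite /sform mulmx_sumr mulmx_suml summxE. Qed.

Definition sformE := (sformDm, sformNm, sformZm, sformDl, sformNl, sformZl,
  sformDr, sformNr, sformZr).

Lemma sform1E n (x : 'cV[C]_n) : sform 1%:M x x = \sum_i `|x i 0| ^+ 2.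
Proof.
rewrite /sform mulmx1 mxE; apply: eq_bigr => i _.
by rewrite !mxE normCK mulrC.
Qed.

Lemma sform1_ge0 n (x : 'cV[C]_n) : 0 <= sform 1%:M x x.
Proof. by rewrite sform1E sumr_ge0 // => i _; rewrite exprn_ge0. Qed.

Lemma sform1_eq0 n (x : 'cV[C]_n) : sform 1%:M x x = 0 -> x = 0.
Proof.
rewrite sform1E => /eqP; rewrite psumr_eq0; last by move=> *; rewrite exprn_ge0.
move=> /allP x0; apply/colP => i; rewrite mxE.
have := x0 i (mem_index_enum _); rewrite sqrf_eq0 normr_eq0.
by move=> /eqP.
Qed.

Lemma sform1_gt0 n (x : 'cV[C]_n) : x != 0 -> 0 < sform 1%:M x x.
Proof.
move=> x0; rewrite lt_neqAle sform1_ge0 andbT eq_sym.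
by apply: contraNneq x0 => /sform1_eq0 ->.
Qed.

(** The diagonal entries of [A *m A^t*] are the squared norms of the rows of [A]. *)
Lemma mul_adjmx_eq0 m n (A : 'M[C]_(m, n)) : A *m A^t* = 0 -> A = 0.
Proof.
move=> A0; suff A't : A^t* = 0 by rewrite -[A]trmxCK A't trmx0 map_mx0.
apply/eqP; rewrite -trmx_eq0; apply/eqP/row_matrixP => i.
rewrite row0 -tr_col; apply/eqP; rewrite trmx_eq0; apply/eqP/sform1_eq0.
by rewrite colE sform_mull mulmx1 trmxCK sform_mulr A0 /sform mulmx0 mul0mx mxE.
Qed.

End Sesquilinear.

(** * Positive semidefinite matrices and the Loewner order *)

Section Positive.
Context {C : numClosedFieldType} {d : nat}.
Implicit Types (A B X Y Z : 'M[C]_d).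

(** Testing at [x + y] and at [x + 'i *: y] gives [a + b = 0] and [a - b = 0] for [a = sform A x y]
    and [b = sform A y x]. *)
Lemma sform_diag_eq0 A : (forall x, sform A x x = 0) -> A = 0.
Proof.
move=> A0; apply: sform_eq0 => x y.
have := A0 (x + y); have := A0 (x + 'i *: y).
rewrite !sformE !A0 conjCi !mulr0 !addr0 !add0r => h1 h2.
have h3 : 'i * (sform A x y - sform A y x) = 0.
  by rewrite mulrBr -mulNr.
move/eqP: h3; rewrite mulf_eq0 (negPf (neq0Ci _)) /= subr_eq0 => /eqP h3.
by move/eqP: h2; rewrite h3 -mulr2n mulrn_eq0 /= => /eqP.
Qed.

Lemma sform_polarization A x y :
  sform A x y = 2^-1 *
    ((sform A (x + y) (x + y) - sform A x x - sform A y y)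
     - 'i * (sform A (x + 'i *: y) (x + 'i *: y) - sform A x x - sform A y y)).
Proof.
have ii : 'i * 'i = -1 :> C by rewrite -expr2 sqrCi.
rewrite !sformE conjCi; set a := sform A x y; set b := sform A y x.
set p := sform A x x; set q := sform A y y.
(* Grouping the powers of ['i] into products ['i * 'i] lets the single relation [ii] eliminate them;
   the [q] terms then cancel. *)
rewrite mulNr [X in _ * (_ - X)](_ : _ = 'i * 'i * a - 'i * 'i * b
  - ('i * 'i + 1) * 'i * q); last by ring.
by rewrite ii; field.
Qed.

(** A nonnegative form is real, so [A] and its adjoint have the same diagonal form and coincide:
    over the complex numbers, Hermitian symmetry comes for free. *)
Lemma psdmxP A : psdmx A <-> forall x, 0 <= sform A x x.
Proof.
split=> [[]//|A_ge0]; split=> //; apply/hermsymmxP.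
apply/eqP; rewrite -subr_eq0; apply/eqP/sform_diag_eq0 => x.
by rewrite !sformE -conj_sform geC0_conj // subrr.
Qed.

Lemma psdmx_adj A : psdmx A -> A^t* = A.
Proof. by case=> /hermsymmxP. Qed.

Lemma psdmxD A B : psdmx A -> psdmx B -> psdmx (A + B).
Proof.
by move=> /psdmxP A0 /psdmxP B0; apply/psdmxP => x; rewrite sformE addr_ge0.
Qed.

Lemma psdmxZ (a : C) A : 0 <= a -> psdmx A -> psdmx (a *: A).
Proof. by move=> a0 /psdmxP A0; apply/psdmxP => x; rewrite sformE mulr_ge0. Qed.

Lemma psdmx0 : psdmx (0 : 'M[C]_d).
Proof. by apply/psdmxP => x; rewrite /sform mulmx0 mul0mx mxE. Qed.

Lemma psdmx1 : psdmx (1%:M : 'M[C]_d).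
Proof. by apply/psdmxP => x; exact: sform1_ge0. Qed.

Lemma psdmx_sum I (r : seq I) (P : pred I) (F : I -> 'M[C]_d) :
  (forall i, P i -> psdmx (F i)) -> psdmx (\sum_(i <- r | P i) F i).
Proof. by move=> F0; elim/big_ind: _ => //; [exact: psdmx0 | exact: psdmxD]. Qed.

Lemma psdmx_congr A B : psdmx A -> psdmx (B^t* *m A *m B).
Proof.
by move=> /psdmxP A0; apply/psdmxP => x; rewrite -sform_mulr -sform_mull.
Qed.

Lemma psdmx_gram A : psdmx (A^t* *m A).
Proof. by rewrite -[A^t*]mulmx1; apply/psdmx_congr/psdmx1. Qed.

Lemma loewner_leP A B :
  loewner_le A B <-> forall x, sform A x x <= sform B x x.
Proof.
by split=> [/psdmxP AB x|AB]; [|apply/psdmxP => x];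
   have := AB x; rewrite !sformE ?subr_ge0.
Qed.

Lemma loewner_le_trans B A Z : loewner_le A B -> loewner_le B Z -> loewner_le A Z.
Proof.
move=> /loewner_leP AB /loewner_leP BZ; apply/loewner_leP => x.
exact: le_trans (AB x) (BZ x).
Qed.

Lemma loewner_le_anti A B : loewner_le A B -> loewner_le B A -> A = B.
Proof.
move=> /loewner_leP AB /loewner_leP BA; apply/eqP; rewrite -subr_eq0.
apply/eqP/sform_diag_eq0 => x; rewrite !sformE; apply/eqP; rewrite subr_eq0.
by rewrite eq_le AB BA.
Qed.

Lemma adjmx_expr A n : A^t* = A -> (A ^+ n)^t* = A ^+ n.
Proof.
move=> AE; elim: n => [|n IH]; first by rewrite expr0 adjmx1.
by rewrite {1}exprSr -mulmxE adjmxM IH AE exprS.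
Qed.

(** Half of the factors move to each side, leaving [A] or the identity in the middle; powers of a
    positive matrix are thus positive. *)
Lemma sform_expr A n x : A^t* = A ->
  sform (A ^+ n) x x =
  sform (if odd n then A else 1%:M) (A ^+ n./2 *m x) (A ^+ n./2 *m x).
Proof.
move=> AE; rewrite sform_mull sform_mulr adjmx_expr //; congr sform.
rewrite -[in LHS](odd_double_half n) -addnn addnA [in LHS]exprD -mulmxE.
congr (_ *m _); case: odd; last by rewrite mulmx1.
by rewrite exprSr -mulmxE.
Qed.

Lemma psdmx_expr A n : psdmx A -> psdmx (A ^+ n).
Proof.
move=> A0; apply/psdmxP => x; rewrite sform_expr ?psdmx_adj//.
by case: odd; [move/psdmxP: A0; exact | exact: sform1_ge0].
Qed.

End Positive.

(** * Spectral decomposition, roots and top eigenvectors *)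

Section Roots.
Context {C : numClosedFieldType} {d : nat}.
Implicit Types (A B X Y Z P : 'M[C]_d) (s : 'rV[C]_d).

Lemma sform_diag_mx s (x : 'cV[C]_d) :
  sform (diag_mx s) x x = \sum_i s 0 i * `|x i 0| ^+ 2.
Proof.
rewrite /sform -mulmxA mul_diag_mx mxE; apply: eq_bigr => i _.
by rewrite !mxE mulrCA normCK [_ * _^*]mulrC.
Qed.

Lemma psdmx_diag s : psdmx (diag_mx s) <-> forall i, 0 <= s 0 i.
Proof.
split=> [/psdmxP s0 i|s0].
  by have := s0 (delta_mx i 0); rewrite sform_delta mxE eqxx.
by apply/psdmxP => x; rewrite sform_diag_mx sumr_ge0 // => i _; rewrite mulr_ge0 ?exprn_ge0.
Qed.

Lemma diag_mx_expr s n : diag_mx s ^+ n = diag_mx (map_mx (fun a => a ^+ n) s).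
Proof.
elim: n => [|n IH].
  rewrite expr0; apply/matrixP => i j; rewrite !mxE.
  by rewrite expr0.
rewrite exprS IH -mulmxE mulmx_diag; congr diag_mx.
by apply/rowP => i; rewrite !mxE exprS.
Qed.

Lemma unitary_congr_expr P A n : P \is unitarymx ->
  (P^t* *m A *m P) ^+ n = P^t* *m A ^+ n *m P.
Proof.
move=> Pu; elim: n => [|n IH].
  by rewrite !expr0 mulmx1 mulmx1C //; apply/unitarymxP.
rewrite !exprS IH -!mulmxE !mulmxA; congr (_ *m _ *m _).
by rewrite mulmxtVK.
Qed.

Lemma unitary_congr_scalar P (a : C) : P \is unitarymx ->
  P^t* *m a%:M *m P = a%:M.
Proof.
by move=> Pu; rewrite scalar_mxC -mulmxA (mulmx1C (unitarymxP Pu)) mulmx1.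
Qed.

Lemma spectral_decomp A : A^t* = A ->
  A = (spectralmx A)^t* *m diag_mx (spectral_diag A) *m spectralmx A.
Proof.
move=> /hermsymmxP /hermitian_normalmx /orthomx_spectralP {1}->.
by rewrite invmx_unitary // spectral_unitarymx.
Qed.

Lemma spectral_diagE A : A^t* = A ->
  diag_mx (spectral_diag A) = spectralmx A *m A *m (spectralmx A)^t*.
Proof.
move=> AE; rewrite {3}(spectral_decomp AE) !mulmxA.
rewrite (unitarymxP (spectral_unitarymx A)) mul1mx.
by rewrite mulmxtVK // spectral_unitarymx.
Qed.

Lemma spectral_diag_ge0 A i : psdmx A -> 0 <= spectral_diag A 0 i.
Proof.
move=> A0; move: i; apply/psdmx_diag; rewrite (spectral_diagE (psdmx_adj A0)).
by have := psdmx_congr (spectralmx A ^t*) A0; rewrite trmxCK.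
Qed.

Lemma spectral_funE f A : spectral_fun f A =
  (spectralmx A)^t* *m diag_mx (map_mx f (spectral_diag A)) *m spectralmx A.
Proof. by rewrite /spectral_fun invmx_unitary // spectral_unitarymx. Qed.

Lemma psdmx_root n A : (0 < n)%N -> psdmx A -> psdmx (mxroot n A).
Proof.
move=> n0 A0; rewrite /mxroot spectral_funE; apply/psdmx_congr/psdmx_diag => i.
by rewrite mxE rootC_ge0 // spectral_diag_ge0.
Qed.

Lemma mxrootK n A : (0 < n)%N -> psdmx A -> mxroot n A ^+ n = A.
Proof.
move=> n0 A0; rewrite /mxroot spectral_funE.
rewrite unitary_congr_expr ?spectral_unitarymx // diag_mx_expr.
rewrite [RHS](spectral_decomp (psdmx_adj A0)); congr (_ *m diag_mx _ *m _).
by apply/rowP => i; rewrite !mxE rootCK.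
Qed.

(** The constant is the sum of the eigenvalues: being nonnegative, each is at most this sum, which
    does not depend on [n]. *)
Lemma psdmx_expr_le_scalar A : psdmx A ->
  exists2 c : C, 0 <= c & forall n, loewner_le (A ^+ n) (c ^+ n)%:M.
Proof.
move=> A0; have s0 i := spectral_diag_ge0 i A0.
exists (\sum_i spectral_diag A 0 i) => [|n]; first by rewrite sumr_ge0.
have Pu := spectral_unitarymx A.
rewrite {1}(spectral_decomp (psdmx_adj A0)) unitary_congr_expr // diag_mx_expr.
set c := \sum_i _.
rewrite -(unitary_congr_scalar (c ^+ n) Pu) /loewner_le -mulmxBl -mulmxBr; apply: psdmx_congr.
rewrite -diag_const_mx -linearB; apply/psdmx_diag => i; rewrite !mxE subr_ge0.
apply: lerXn2r; rewrite ?nnegrE ?sumr_ge0 //.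
by rewrite /c (bigD1 i) //= lerDl sumr_ge0.
Qed.

Lemma unitmx_expr A n : A \in unitmx -> A ^+ n \in unitmx.
Proof.
move=> Au; elim: n => [|n IH]; first by rewrite expr0 unitmx1.
by rewrite exprS -mulmxE unitmx_mul Au.
Qed.

Lemma unitmx_root n A : (0 < n)%N -> psdmx A -> A \in unitmx ->
  mxroot n A \in unitmx.
Proof.
move=> n0 A0; rewrite -{1}(mxrootK n0 A0) -(prednK n0) exprS -mulmxE unitmx_mul.
by case/andP.
Qed.

Lemma psdmx_sqrt A : psdmx A -> A \in unitmx ->
  exists S, [/\ psdmx S, S \in unitmx & S *m S = A].
Proof.
move=> A0 Au; exists (mxroot 2 A); split; first exact: psdmx_root.
  exact: unitmx_root.
by rewrite mulmxE -expr2 mxrootK.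
Qed.

Lemma sform_psd_unit_gt0 A (x : 'cV[C]_d) : psdmx A -> A \in unitmx -> x != 0 ->
  0 < sform A x x.
Proof.
move=> A0 Au x0; have [S [S0 Su SS]] := psdmx_sqrt A0 Au.
rewrite -SS -{1}(psdmx_adj S0) sform_gram.
apply: sform1_gt0; apply: contraNneq x0 => Sx0.
by rewrite -(mulKmx Su x) Sx0 mulmx0.
Qed.

Hypothesis d_gt0 : (0 < d)%N.

(** The eigenvalues of a Hermitian matrix are real, hence comparable, and [d > 0] provides at least
    one. The eigenvector is a column of the adjoint of [spectralmx A]. *)
Lemma top_eigenvector A : A^t* = A -> exists (mu : C) (v : 'cV[C]_d),
  [/\ mu \is Num.real, v != 0, A *m v = mu *: v & loewner_le A mu%:M].
Proof.
move=> AE; have Pu := spectral_unitarymx A.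
have /mxOverP sR := hermitian_spectral_diag_real ((hermsymmxP _).2 AE).
case: (@real_arg_maxP _ _ (Ordinal d_gt0) xpredT (spectral_diag A 0)) => //= i _ maxi.
exists (spectral_diag A 0 i), ((spectralmx A)^t* *m delta_mx i 0); split=> //.
- apply/eqP => /(congr1 (mulmx (spectralmx A))).
  rewrite mulmxA (unitarymxP Pu) mul1mx mulmx0 => /matrixP /(_ i 0).
  by rewrite !mxE !eqxx => /eqP; rewrite oner_eq0.
- rewrite {1}(spectral_decomp AE) -!mulmxA (mulmxA _ _ (delta_mx i 0)).
  rewrite (unitarymxP Pu) mul1mx scalemxAr; congr (_ *m _).
  apply/matrixP => k l; rewrite mul_diag_mx !mxE.
  by have [->|] := eqVneq k i; rewrite // !mulr0.
- set c := spectral_diag A 0 i.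
  rewrite -(unitary_congr_scalar c Pu) [A in loewner_le A](spectral_decomp AE).
  rewrite /loewner_le -mulmxBl -mulmxBr; apply: psdmx_congr.
  rewrite -diag_const_mx -linearB; apply/psdmx_diag => j; rewrite !mxE subr_ge0.
  exact: maxi.
Qed.

(** With [S] the square root of [A], a top eigenvector [v] of [invmx S *m Z *m invmx S] is pulled
    back to [w = invmx S *m v]. *)
Lemma top_generalized_eigenvector Z A : Z^t* = Z -> psdmx A -> A \in unitmx ->
  exists (mu : C) (w : 'cV[C]_d), [/\ mu \is Num.real, w != 0,
    Z *m w = mu *: (A *m w) & loewner_le Z (mu *: A)].
Proof.
move=> ZE A0 Au; have [S [S0 Su SS]] := psdmx_sqrt A0 Au.
have SE := psdmx_adj S0.
have S'E : (invmx S)^t* = invmx S.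
  rewrite -[RHS]mul1mx -(adjmx1 d) -(mulmxV Su) adjmxM SE.
  by rewrite mulmxK.
have [|mu [v [muR v0 vE leW]]] := @top_eigenvector (invmx S *m Z *m invmx S).
  by rewrite !adjmxM S'E ZE mulmxA.
exists mu, (invmx S *m v); split=> //.
- by apply: contraNneq v0 => w0; rewrite -(mulKVmx Su v) w0 mulmx0.
- rewrite -SS -(mulmxA S) mulKVmx // scalemxAr -vE !mulmxA.
  by rewrite mulmxV // mul1mx.
- have := psdmx_congr S leW; rewrite SE mulmxBr mulmxBl !mulmxA mulmxV // mul1mx.
  by rewrite mulmxKV // mul_mx_scalar -scalemxAl SS.
Qed.

End Roots.

(** * Domination of moment sequences and monotonicity of roots *)

Section PowerDomination.
Context {C : numClosedFieldType} {d : nat}.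
Hypothesis d_gt0 : (0 < d)%N.
Implicit Types (A B X Y Z P Q : 'M[C]_d).

Section MomentSequence.
Variables (Y : 'M[C]_d) (Z : nat -> 'M[C]_d).
Hypotheses (Y_psd : psdmx Y) (Y_unit : Y \in unitmx).
Hypothesis Z_adj : forall j, (Z j)^t* = Z j.
(* Positivity of the block matrix [[Z_j, -Z_{j+1}], [-Z_{j+1}, Z_{j+2}]]. *)
Hypothesis Z_block : forall j (x y : 'cV[C]_d),
  0 <= sform (Z j) x x - sform (Z j.+1) x y - sform (Z j.+1) y x
       + sform (Z j.+2) y y.
Hypothesis Z0_le1 : loewner_le (Z 0%N) 1%:M.

(** The case [k = 1] is the one applied afterwards; the general factor serves the induction. If the
    top generalized eigenvalue [mu] of the pair to be bounded exceeded [k], the induction hypothesis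
    would apply with the factor [mu]. *)
Lemma moment_step m (k : C) : 1 <= k ->
  loewner_le (Z m.+1) (k *: Y ^+ m.+1) -> loewner_le (Z m) (k *: Y ^+ m).
Proof.
have Yadj := psdmx_adj Y_psd.
elim: m k => [|m IH] k k1 leZ.
  apply: loewner_le_trans Z0_le1 _; rewrite /loewner_le expr0.
  have -> : k *: (1 : 'M[C]_d) - 1%:M = (k - 1) *: 1%:M.
    by rewrite scalerBl scale1r.
  by apply: psdmxZ; [rewrite subr_ge0 | exact: psdmx1].
have [mu [w [muR w0 wE leZmu]]] := top_generalized_eigenvector d_gt0
  (Z_adj m.+1) (psdmx_expr m.+1 Y_psd) (unitmx_expr m.+1 Y_unit).
suff le_mu_k : mu <= k.
  apply: loewner_le_trans leZmu _; rewrite /loewner_le -scalerBl.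
  by apply: psdmxZ; [rewrite subr_ge0 | exact: psdmx_expr].
have kR : k \is Num.real by apply: ger1_real.
have [//|lt_k_mu] := real_leP muR kR.
have mu1 : 1 <= mu by apply: le_trans k1 (ltW lt_k_mu).
have leZm := IH mu mu1 leZmu.
(* Otherwise [mu > k], and the block form is negative at [(Y w, w)]: it is at
   most [mu g - 2 mu g + k g = (k - mu) g]. *)
set g := sform (Y ^+ m.+2) w w.
have g_gt0 : 0 < g.
  by apply: sform_psd_unit_gt0 => //; [exact: psdmx_expr|exact: unitmx_expr].
have := Z_block m (Y *m w) w.
have le1 : sform (Z m) (Y *m w) (Y *m w) <= mu * g.
  have /loewner_leP /(_ (Y *m w)) := leZm; rewrite sformE => /le_trans; apply.
  rewrite sform_mulr sform_mull Yadj !mulmxE -exprSr -exprS.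
  by [].
have le2 : sform (Z m.+2) w w <= k * g.
  by have /loewner_leP /(_ w) := leZ; rewrite sformE.
have E1 : sform (Z m.+1) (Y *m w) w = mu * g.
  rewrite -[Z _]mul1mx -sform_mulr wE sformZr sform_mulr sform_mull Yadj.
  by rewrite mul1mx mulmxE -exprS.
have E2 : sform (Z m.+1) w (Y *m w) = mu * g.
  rewrite -[LHS]conjCK conj_sform Z_adj E1 rmorphM /=.
  by rewrite (CrealP muR) (CrealP (gtr0_real g_gt0)).
rewrite E1 E2 => h.
have : (k - mu) * g < 0.
  by rewrite pmulr_llt0 // subr_lt0.
suff : 0 <= (k - mu) * g by move=> /le_lt_trans /[apply]; rewrite ltxx.
apply: le_trans h _; rewrite mulrBl -subr_ge0.
set a := sform (Z m) _ _ in le1 *; set b := sform (Z m.+2) _ _ in le2 *.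
have -> : k * g - mu * g - (a - mu * g - mu * g + b) = (mu * g - a) + (k * g - b).
  by rewrite !opprD !opprK; ring.
by rewrite addr_ge0 ?subr_ge0.
Qed.

Lemma moment_dominated m j : (j <= m)%N ->
  loewner_le (Z m) (Y ^+ m) -> loewner_le (Z j) (Y ^+ j).
Proof.
elim: m => [|m IH]; first by rewrite leqn0 => /eqP ->.
rewrite leq_eqVlt => /predU1P [-> //|/IH {}IH] leZ; apply: IH.
by rewrite -[Y ^+ m]scale1r; apply: moment_step; rewrite ?scale1r.
Qed.

End MomentSequence.

(** The expression is the form of [X ^+ j] at [x - X *m y]. *)
Lemma expr_block X j x y : psdmx X ->
  0 <= sform (X ^+ j) x x - sform (X ^+ j.+1) x y - sform (X ^+ j.+1) y x
       + sform (X ^+ j.+2) y y.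
Proof.
move=> X0; have /psdmxP /(_ (x - X *m y)) := psdmx_expr j X0.
rewrite !sformE !sform_mulr !sform_mull !(psdmx_adj X0) !mulmxE -exprSr.
by rewrite -!exprS opprK addrA.
Qed.

Lemma psdmx_scalar (e : C) : 0 <= e -> psdmx (e%:M : 'M[C]_d).
Proof. by move=> e0; rewrite -scalemx1; apply: psdmxZ => //; exact: psdmx1. Qed.

Lemma psdmx_add_scalar_unit Y (e : C) : psdmx Y -> 0 < e ->
  Y + e%:M \in unitmx.
Proof.
move=> /psdmxP Y0 e0; rewrite -row_free_unit -kermx_eq0.
apply/rowV0P => v /sub_kermxP vY0; rewrite -[v]trmxCK.
suff -> : v^t* = 0 by rewrite trmx0 map_mx0.
have : sform (Y + e%:M) (v^t*) (v^t*) = 0.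
  by rewrite /sform trmxCK vY0 mul0mx mxE.
rewrite -scalemx1 !sformE => /eqP.
rewrite paddr_eq0 ?mulr_ge0 ?sform1_ge0 ?(ltW e0) // => /andP[_].
by rewrite mulf_eq0 (gt_eqF e0) => /eqP /sform1_eq0.
Qed.

(** Powers are not Loewner monotone in general. Here [e%:M] commutes with [Y], so the binomial
    expansion is [Y ^+ n] plus positive terms. *)
Lemma expr_le_add_scalar Y (e : C) n : psdmx Y -> 0 < e ->
  loewner_le (Y ^+ n) ((Y + e%:M) ^+ n).
Proof.
move=> Y0 e0; rewrite exprDn_comm; last by rewrite /GRing.comm -!mulmxE scalar_mxC.
rewrite big_ord_recl /= subn0 expr0 mulr1 bin0 mulr1n /loewner_le addrC addKr.
apply: psdmx_sum => i _; rewrite -scaler_nat; apply: psdmxZ; first exact: ler0n.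
rewrite -rmorphXn -mulmxE mul_mx_scalar; apply: psdmxZ; last exact: psdmx_expr.
by rewrite exprn_ge0 // ltW.
Qed.

Lemma loewner_le_eps A B :
  (forall e : C, 0 < e -> loewner_le A (B + e%:M)) -> loewner_le A B.
Proof.
move=> leAB; apply/loewner_leP => x; rewrite -subr_ge0.
set D := _ - _; set g := sform 1%:M x x; have g0 : 0 <= g := sform1_ge0 x.
have DE e : 0 < e -> 0 <= D + e * g.
  move=> /leAB /loewner_leP /(_ x); rewrite -scalemx1 !sformE -subr_ge0.
  by rewrite /D /g addrAC.
have g1 : 0 < 1 + g by rewrite ltr_pwDl.
(* The order of [C] is partial: [D] must be known to be real before its sign can be discussed. *)
have DR : D \is Num.real.
  have := ger0_real (DE 1 ltr01); rewrite mul1r => DgR.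
  by rewrite -(addrK g D) rpredB // ger0_real.
have [//|D_lt0] := real_leP (real0 _) DR.
(* This value of [e] turns [D + e * g] into [D / (1 + g)], which is negative; the denominator is not
   [g], which may vanish. *)
have := DE (- D / (1 + g)) _; rewrite divr_gt0 ?oppr_gt0 // => /(_ isT).
suff -> : D + - D / (1 + g) * g = D / (1 + g).
  by rewrite pmulr_lge0 ?invr_gt0 // (lt_geF D_lt0).
by field; rewrite gt_eqF.
Qed.

(** This is [moment_dominated] for [Z j = X ^+ j], descending from [n] to 1. As [Y] may be singular,
    it is first shifted by [e]. *)
Lemma root_mono X Y n : (0 < n)%N -> psdmx X -> psdmx Y ->
  loewner_le (X ^+ n) (Y ^+ n) -> loewner_le X Y.
Proof.
move=> n0 X0 Y0 leXY; apply: loewner_le_eps => e e0.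
have Ye0 : psdmx (Y + e%:M) by apply: psdmxD => //; apply/psdmx_scalar/ltW.
have := @moment_dominated (Y + e%:M) (fun j => X ^+ j) Ye0
  (psdmx_add_scalar_unit Y0 e0) (fun j => psdmx_adj (psdmx_expr j X0))
  (fun j x y => expr_block j x y X0).
move=> /(_ _ n 1%N n0); rewrite !expr1; apply.
  by rewrite expr0 /loewner_le subrr; exact: psdmx0.
exact: loewner_le_trans leXY (expr_le_add_scalar n Y0 e0).
Qed.

(** Roots can henceforth be identified by their powers, without comparing spectral
    decompositions. *)
Lemma root_unique X Y n : (0 < n)%N -> psdmx X -> psdmx Y ->
  X ^+ n = Y ^+ n -> X = Y.
Proof.
move=> n0 X0 Y0 XY; apply: loewner_le_anti; apply: (@root_mono _ _ n) => //;
by rewrite XY /loewner_le subrr; exact: psdmx0.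
Qed.

(** Means are used instead of sums because the factor [2^-1] makes [Z 0] the identity. Descending
    from [m] to [n] bounds [Z n] by [(Y + e%:M) ^+ n], and [n]-th roots are then compared. *)
Lemma mean_power_root_mono P Q n m : (0 < n)%N -> (n <= m)%N ->
  psdmx P -> psdmx Q ->
  loewner_le (mxroot n (2^-1 *: (P ^+ n + Q ^+ n)))
             (mxroot m (2^-1 *: (P ^+ m + Q ^+ m))).
Proof.
move=> n0 nm P0 Q0; have m0 := leq_trans n0 nm.
pose Z j := 2^-1 *: (P ^+ j + Q ^+ j).
have h0 : 0 <= 2^-1 :> C by rewrite invr_ge0 ler0n.
have Z0 j : psdmx (Z j) by apply/psdmxZ/psdmxD => //; exact: psdmx_expr.
rewrite -/(Z n) -/(Z m); set X := mxroot n _; set Y := mxroot m _.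
have X0 : psdmx X by exact: psdmx_root.
have Y0 : psdmx Y by exact: psdmx_root.
apply: loewner_le_eps => e e0.
have Ye0 : psdmx (Y + e%:M) by apply: psdmxD => //; apply/psdmx_scalar/ltW.
have Yeu := psdmx_add_scalar_unit Y0 e0.
apply: (@root_mono _ _ n) => //.
rewrite /X mxrootK //.
apply: (moment_dominated Ye0 Yeu _ _ _ nm) => [j|j x y||].
- exact: psdmx_adj.
- have := mulr_ge0 h0 (addr_ge0 (expr_block j x y P0) (expr_block j x y Q0)).
  by rewrite /Z !sformE => /le_trans; apply; rewrite le_eqVlt; apply/orP; left; apply/eqP; ring.
- rewrite /Z !expr0 /loewner_le.
  have -> : 2^-1 *: (1 + 1 : 'M[C]_d) = 1%:M.
    by rewrite scalerDr -scalerDl (_ : 2^-1 + 2^-1 = 1) ?scale1r //; field.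
  by rewrite subrr; exact: psdmx0.
- apply: loewner_le_trans (expr_le_add_scalar m Y0 e0).
  by rewrite /Y mxrootK // /loewner_le subrr; exact: psdmx0.
Qed.

End PowerDomination.

(** * Polar decomposition and the inequality for sums *)

Section Polar.
Context {C : numClosedFieldType} {d : nat}.
Hypothesis d_gt0 : (0 < d)%N.
Implicit Types (A B T H M : 'M[C]_d).

Lemma adjmx_inv A : A \in unitmx -> (invmx A)^t* = invmx (A^t*).
Proof.
move=> Au; have A'u : A^t* \in unitmx by rewrite map_unitmx unitmx_tr.
by rewrite -[LHS]mul1mx -(mulVmx A'u) -mulmxA -adjmxM mulVmx // adjmx1 mulmx1.
Qed.

(** The dimension [k] is tied to the rank by an equation, so that bases of two kernels of equal rank
    have the same type and can be composed. *)
Lemma kernel_orthonormal_basis M k : \rank (kermx M) = k ->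
  exists2 B : 'M[C]_(k, d), B \is unitarymx & (B :=: kermx M)%MS.
Proof.
move=> <-; exists (schmidt (row_base (kermx M))).
  exact/schmidt_unitarymx/rank_leq_col.
apply: eqmx_trans (eq_row_base _); apply: eqmx_schmidt_free.
exact: row_base_free.
Qed.

Lemma absmx_psd A : psdmx (absmx A).
Proof. by apply: psdmx_root => //; exact: psdmx_gram. Qed.

Lemma absmxK A : absmx A *m absmx A = A^t* *m A.
Proof. by rewrite mulmxE -expr2 mxrootK //; exact: psdmx_gram. Qed.

(** Sending [|T| x] to [T x] is isometric; this extends to a unitary because the kernel of [|T|] and
    the orthogonal complement of the range of [T] have the same dimension. *)
Lemma polar_decomposition T :
  exists2 U : 'M[C]_d, U \is unitarymx & T = U *m absmx T.
Proof.
have := absmxK T; have := psdmx_adj (absmx_psd T).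
move: (absmx T) => H Hadj HH.
(* For a row [v], the rows [v *m H] and [v *m T^t*] have the same norm, since
   [H *m H = T^t* *m T]. *)
have kerE : (kermx (T^t*) :=: kermx H)%MS.
  apply/eqmxP/andP; split; apply/rV_subP => v /sub_kermxP v0; apply/sub_kermxP;
    apply: mul_adjmx_eq0; rewrite adjmxM !mulmxA.
    by rewrite Hadj -(mulmxA v) HH mulmxA v0 !mul0mx.
  by rewrite trmxCK -(mulmxA v) -HH mulmxA v0 !mul0mx.
have [k kE] : exists k, \rank (kermx H) = k by exists (\rank (kermx H)).
have [A Au AE] := kernel_orthonormal_basis kE.
have [|B Bu BE] := @kernel_orthonormal_basis T k.
  by rewrite -kE -kerE !mxrank_ker mxrank_map mxrank_tr.
have AH : A *m H = 0 by apply/sub_kermxP; rewrite AE.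
have BT : B *m T = 0 by apply/sub_kermxP; rewrite BE.
have HA : H *m A^t* = 0 by rewrite -{1}Hadj -adjmxM AH trmx0 map_mx0.
have TB : T^t* *m B^t* = 0 by rewrite -adjmxM BT trmx0 map_mx0.
have TA : T *m A^t* = 0.
  suff AT : A *m T^t* = 0 by rewrite -[T]trmxCK -adjmxM AT trmx0 map_mx0.
  apply: mul_adjmx_eq0; rewrite adjmxM trmxCK !mulmxA -(mulmxA A) -HH !mulmxA.
  by rewrite AH !mul0mx.
(* [A^t* *m A] is the orthogonal projection onto the kernel of [H]. Adding it to [H] gives an
   invertible matrix, and [T *m G = T *m H] because [T] vanishes on that kernel. *)
set G := H + A^t* *m A.
have Gadj : G^t* = G by rewrite /G adjmxD Hadj adjmxM trmxCK.
have GG : G *m G = H *m H + A^t* *m A.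
  rewrite /G mulmxDl !mulmxDr !mulmxA HA mul0mx addr0.
  by rewrite -(mulmxA _ A H) AH mulmx0 add0r mulmxtVK.
have Gu : G \in unitmx.
  rewrite -row_free_unit -kermx_eq0; apply/rowV0P => v /sub_kermxP vG.
  have : sform (G *m G) (v^t*) (v^t*) = 0.
    by rewrite /sform trmxCK mulmxA vG !mul0mx mxE.
  rewrite GG sformE -{1}Hadj !sform_gram => /eqP.
  rewrite paddr_eq0 ?sform1_ge0 // => /andP[/eqP/sform1_eq0 Hv /eqP/sform1_eq0 Av].
  have vH : v *m H = 0.
    by rewrite -[v]trmxCK -Hadj -adjmxM Hv trmx0 map_mx0.
  (* Thus [v = c *m A]; as the rows of [A] are orthonormal, [Av] says that the adjoint of [c] is
     zero. *)
  have : (v <= A)%MS by rewrite AE; apply/sub_kermxP.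
  case/submxP => c vE; move: Av; rewrite vE adjmxM mulmxA (unitarymxP Au) mul1mx.
  by move=> /(congr1 (fun N => N^t*)); rewrite trmxCK => ->; rewrite trmx0 map_mx0 mul0mx.
(* [A] is an orthonormal basis of the kernel of [H = |T|] and [B^t* A] maps this
   kernel isometrically onto the orthogonal complement of the range of [T]. *)
exists ((T + B^t* *m A) *m invmx G).
  apply/unitarymxP/mulmx1C; rewrite adjmxM adjmx_inv // Gadj -mulmxA.
  rewrite (mulmxA _ _ (invmx G)).
  have -> : (T + B^t* *m A)^t* *m (T + B^t* *m A) = G *m G.
    rewrite GG adjmxD adjmxM trmxCK mulmxDl !mulmxDr !mulmxA TB mul0mx addr0.
    by rewrite -(mulmxA _ B T) BT mulmx0 add0r mulmxtVK // HH.
  by rewrite mulmxK // mulVmx.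
have GH : G *m H = H *m G.
  by rewrite /G mulmxDl mulmxDr mulmxA HA mul0mx -mulmxA AH mulmx0.
have -> : (T + B^t* *m A) *m invmx G *m H = (T + B^t* *m A) *m H *m invmx G.
  rewrite -!mulmxA; congr (_ *m _).
  by rewrite -[H in LHS](mulmxK Gu) -GH -mulmxA mulKmx.
rewrite mulmxDl -mulmxA AH mulmx0 addr0.
have -> : T *m H = T *m G by rewrite /G mulmxDr mulmxA TA mul0mx addr0.
by rewrite mulmxK.
Qed.

(** Both sides are positive with square [T *m T^t*], so uniqueness of square roots applies. *)
Lemma absmx_adj T U : U \is unitarymx -> T = U *m absmx T ->
  absmx (T^t*) = U *m absmx T *m U^t*.
Proof.
move=> Uu TE; apply: (@root_unique _ _ d_gt0 _ _ 2) => //.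
- exact: absmx_psd.
- by have := psdmx_congr (U^t*) (absmx_psd T); rewrite trmxCK.
have Hadj := psdmx_adj (absmx_psd T).
rewrite !expr2 -!mulmxE absmxK trmxCK [in LHS]TE adjmxM Hadj !mulmxA.
by rewrite -(mulmxA _ _ U) (mulmx1C (unitarymxP Uu)) mulmx1.
Qed.

(** With [A = U |A|], the expression is the form of [|A|] at [U^t* *m y + x]. *)
Lemma absmx_block A (x y : 'cV[C]_d) :
  0 <= sform (absmx (A^t*)) y y + sform A y x + sform (A^t*) x y
       + sform (absmx A) x x.
Proof.
have [U Uu AE] := polar_decomposition A; rewrite (absmx_adj Uu AE).
have H0 := absmx_psd A; move: (absmx A) H0 AE => H H0 ->.
have /psdmxP /(_ (U^t* *m y + x)) := H0; rewrite adjmxM (psdmx_adj H0).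
by rewrite !(sformDl, sformDr) !sform_mull !sform_mulr trmxCK !addrA.
Qed.

Lemma absmx_sum_le I (r : seq I) (A M : I -> 'M[C]_d) :
  (forall k, loewner_le (absmx (A k)) (M k)) ->
  (forall k, loewner_le (absmx ((A k)^t*)) (M k)) ->
  exists V : 'M[C]_d, V \is unitarymx /\
    loewner_le (absmx (\sum_(k <- r) A k))
      (2^-1 *: \sum_(k <- r) (M k + V *m M k *m V^t*)).
Proof.
move=> leA leA'; set T := \sum_(k <- r) A k; set S := \sum_(k <- r) M k.
have [U Uu TE] := polar_decomposition T.
exists (U^t*); rewrite trmxC_unitary; split=> //.
have block x y : 0 <= sform S y y + sform T y x + (sform T y x)^* + sform S x x.
  rewrite /S /T !sform_sum rmorph_sum -!big_split /= sumr_ge0 // => k _.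
  apply: le_trans (absmx_block (A k) x y) _; rewrite conj_sform.
  have /loewner_leP leAx := leA k; have /loewner_leP leAx' := leA' k.
  by rewrite lerD // !lerD2r.
apply/loewner_leP => x; rewrite big_split -mulmx_suml -mulmx_sumr trmxCK -/S.
(* At this vector both cross terms become [- sform (absmx T) x x], by [T = U |T|]. *)
have := block x (- (U *m x)); rewrite !(sformNl, sformNr) opprK.
rewrite {1 2}TE !sform_mull !sform_mulr !mulmxA.
rewrite (mulmx1C (unitarymxP Uu)) mul1mx rmorphN /= conj_sform.
rewrite (psdmx_adj (absmx_psd T)) sformZm sformDm => h.
rewrite -subr_ge0 -(pmulr_rge0 _ (ltr0n _ 2)); apply: le_trans h _.
rewrite le_eqVlt; apply/orP; left; apply/eqP.
by field.
Qed.

End Polar.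

(** * Entrywise limits of matrices and closedness of the Loewner order *)

Section MatrixLimits.

Lemma mx_cvg (T : topologicalType) m n I (F : set_system I) {FF : Filter F}
    (M : I -> 'M[T]_(m, n)) (L : 'M[T]_(m, n)) :
  (forall i j, (fun k => M k i j) @ F --> L i j) -> M @ F --> L.
Proof.
move=> ML A [P PL PA].
suff : F [set k | forall i j, P i j (M k i j)].
  by apply: (@filterS _ F _ _ (M @^-1` A)) => k Pk; exact: PA.
apply: filter_forall => i; apply: filter_forall => j.
exact: ML (PL i j).
Qed.

Lemma cvg_coord (K : numFieldType) m n I (F : set_system I) {FF : Filter F}
    (M : I -> 'M[K^o]_(m, n)) (L : 'M[K^o]_(m, n)) i j :
  M @ F --> L -> (fun k => M k i j) @ F --> L i j.
Proof.
move=> ML; apply: (@cvg_comp _ _ _ M (fun N : 'M[K^o]_(m, n) => N i j) _ _ _ ML).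
exact: (@coord_continuous K).
Qed.

(** The order may be partial, so nonnegativity is read as the equality of [l] with its norm, which
    passes to the limit by continuity of the norm and uniqueness of limits. *)
Lemma cvg_ge0 (K : numFieldType) (u : nat -> K^o) (l : K^o) :
  (\forall n \near \oo, 0 <= u n) -> u @ \oo --> l -> 0 <= l.
Proof.
move=> u0 ul; suff -> : l = `|l| by [].
apply: (cvg_unique (@norm_hausdorff K K^o) ul).
apply: cvg_trans (cvg_norm ul); apply: near_eq_cvg.
by apply: filterS u0 => n un0; rewrite ger0_norm.
Qed.

Lemma cvg_sform (C : numClosedFieldType) d (M : nat -> 'M[C^o]_d) (L : 'M[C^o]_d)
    (x y : 'cV[C]_d) :
  M @ \oo --> L -> (fun n => sform (M n) x y : C^o) @ \oo --> (sform L x y : C^o).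
Proof.
move=> ML.
have E (A : 'M[C]_d) : sform A x y = \sum_j (\sum_i (x i 0)^* * A i j) * y j 0.
  rewrite /sform mxE; apply: eq_bigr => j _; rewrite mxE; congr (_ * _).
  by apply: eq_bigr => i _; rewrite !mxE.
rewrite E; under eq_fun do rewrite E.
apply: cvg_big => [|j _]; first exact: add_continuous.
apply: cvgM; last exact: cvg_cst.
apply: cvg_big => [|i _]; first exact: add_continuous.
apply: cvgM; first exact: cvg_cst.
exact: cvg_coord.
Qed.

Lemma cvg_loewner_ge (C : numClosedFieldType) d (A : 'M[C]_d)
    (M : nat -> 'M[C^o]_d) (L : 'M[C^o]_d) :
  (\forall n \near \oo, loewner_le A (M n)) -> M @ \oo --> L -> loewner_le A L.
Proof.
move=> AM ML; apply/loewner_leP => x; rewrite -subr_ge0.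
apply: (@cvg_ge0 _ (fun n => sform (M n) x x - sform A x x)).
  by apply: filterS AM => n /loewner_leP /(_ x); rewrite subr_ge0.
by apply: cvgB; [exact: cvg_sform | exact: cvg_cst].
Qed.

End MatrixLimits.

(** * Convergence of complex sequences *)

Section ComplexSequences.
Variable R : realType.

Lemma cvg_real_complex (u : nat -> R) (l : R) : u @ \oo --> l ->
  (fun n => (real_complex R (u n)) : R[i]^o) @ \oo --> (real_complex R l : R[i]^o).
Proof.
move=> ul; apply/(@cvgrPdist_lt R[i] R[i]^o) => e; rewrite ltcE /= => /andP[/eqP e0 ege0].
have /cvgrPdist_lt /(_ _ ege0) := ul; apply: filterS => n un.
rewrite -rmorphB normc_def /= expr0n addr0 sqrtr_sqr ltcE /=.
by rewrite e0 eqxx.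
Qed.

(** Comparable complex numbers have equal imaginary parts: the imaginary part of [u] is constant,
    and its real part is monotone and bounded. *)
Lemma nondecreasing_cvg_complex (u : nat -> R[i]^o) (c : R[i]) :
  {homo u : n m / (n <= m)%N >-> n <= m} -> (forall n, u n <= c) ->
  cvg (u @ \oo).
Proof.
move=> umono uc; pose v n := complex.Re (u n).
have uE n : u n = real_complex R (v n) + (u 0%N - real_complex R (v 0%N)).
  have := umono _ _ (leq0n n); rewrite /v lecE.
  case: (u n) (u 0%N) => [a b] [a' b'] /= /andP[/eqP -> _].
  by apply/eqP; rewrite eq_complex /= !(subrr, addr0, add0r, oppr0) !eqxx.
have vc : cvgn v.
  apply: nondecreasing_is_cvgn.
    by move=> n m nm; have := umono _ _ nm; rewrite lecE => /andP[].
  exists (complex.Re c) => _ [n _ <-].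
  by have := uc n; rewrite lecE => /andP[].
rewrite (funext uE); apply: is_cvgD; last exact: is_cvg_cst.
by apply/cvg_ex; eexists; apply: cvg_real_complex vc.
Qed.

Lemma cvg_rootC (a : R[i]) : 1 <= a ->
  (fun n => n.+1.-root a : R[i]^o) @ \oo --> (1 : R[i]^o).
Proof.
move=> a1; pose h n := n.+1.-root a - 1.
have h0 n : 0 <= h n by rewrite subr_ge0 rootC_ge1.
(* With [n.+1.-root a = 1 + h n], this follows from Bernoulli's inequality in the weak form
   [k * x <= (1 + x) ^+ k]. *)
have hle n : n.+1%:R * h n <= a.
  rewrite -[leRHS](rootCK (ltn0Sn n)) -[n.+1.-root a](subrK 1) -/(h n) addrC.
  move: (n.+1) (h n) (h0 n) => k x x0; elim: k => [|k IH].
    by rewrite mul0r expr0.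
  rewrite exprS mulrDl mul1r -natr1 mulrDl mul1r addrC.
  rewrite addrC lerD // ler_peMr // exprn_ege1 //.
  by rewrite lerDl.
apply/(@cvgrPdist_lt R[i] R[i]^o) => e e0.
have [e_im e_re] : complex.Im e = 0 /\ 0 < complex.Re e.
  by move: e0; rewrite ltcE => /andP[/eqP].
(* From this rank on, [n.+1 * h n <= a <= n * e < n.+1 * e]. *)
apply: filterS (nbhs_infty_ger (complex.Re a / complex.Re e)) => n.
rewrite ler_pdivrMr // => le_an; rewrite distrC -/(h n) ger0_norm //.
rewrite -(ltr_pM2l (_ : 0 < n.+1%:R)) ?ltr0n //.
apply: le_lt_trans (hle n) _.
have a_im : complex.Im a = 0 by move: a1; rewrite lecE => /andP[/eqP].
rewrite [a]complexE [e]complexE e_im a_im !mulr0 !addr0.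
rewrite -(rmorph_nat (real_complex R)) -rmorphM ltcR.
by apply: le_lt_trans le_an _; rewrite ltr_pM2r // ltr_nat.
Qed.

End ComplexSequences.

(** * Bounds on Kato's sequence *)

Section KatoSequence.
Context {C : numClosedFieldType} {d : nat}.
Hypothesis d_gt0 : (0 < d)%N.
Implicit Types A P Q : 'M[C]_d.

(** If [a] and [b] bound the powers of [P] and [Q], then [a + b] works, since the mean of [a ^+ n]
    and [b ^+ n] is at most [(a + b) ^+ n]. *)
Lemma mean_power_root_bounded P Q : psdmx P -> psdmx Q ->
  exists c : C, forall n, (0 < n)%N ->
    loewner_le (mxroot n (2^-1 *: (P ^+ n + Q ^+ n))) c%:M.
Proof.
move=> P0 Q0.
have [a a0 Pa] := psdmx_expr_le_scalar P0.
have [b b0 Qb] := psdmx_expr_le_scalar Q0.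
have h0 : 0 <= 2^-1 :> C by rewrite invr_ge0 ler0n.
exists (a + b) => n n0.
have S0 : psdmx (2^-1 *: (P ^+ n + Q ^+ n)).
  by apply/psdmxZ/psdmxD => //; exact: psdmx_expr.
apply: (root_mono d_gt0 n0 (psdmx_root n0 S0) (psdmx_scalar (addr_ge0 a0 b0))).
rewrite mxrootK //.
have -> : (a + b)%:M ^+ n = ((a + b) ^+ n)%:M :> 'M[C]_d by rewrite -rmorphXn.
apply/loewner_leP => x.
have /loewner_leP /(_ x) := Pa n; have /loewner_leP /(_ x) := Qb n.
rewrite -!(scalemx1 _ (_ ^+ n)) !sformE.
have := sform1_ge0 x; set p := sform (P ^+ n) _ _; set r := sform (Q ^+ n) _ _.
set g := sform 1%:M _ _ => g0 rb pa.
have lepow : 2^-1 * (a ^+ n + b ^+ n) <= (a + b) ^+ n.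
  rewrite ler_pdivrMl ?ltr0n // mulr_natl mulr2n.
  by apply: lerD; apply: lerXn2r; rewrite ?nnegrE ?addr_ge0 // ?lerDl ?lerDr.
apply: (@le_trans _ _ (2^-1 * (a ^+ n + b ^+ n) * g)); last exact: ler_wpM2r.
by rewrite -mulrA mulrDl ler_wpM2l // lerD.
Qed.

Lemma exprZmx (a : C) A n : (a *: A) ^+ n = a ^+ n *: A ^+ n.
Proof.
elim: n => [|n IH]; first by rewrite !expr0 scale1r.
by rewrite !exprS IH -!mulmxE -scalemxAl -scalemxAr scalerA.
Qed.

(** This splits off a scalar tending to 1 from the monotone sequence of power means. Both sides have
    the same power of order [n.+1], and roots are unique. *)
Lemma kato_seqE A n : kato_seq A n.+1 = n.+1.-root 2 *:
  mxroot n.+1 (2^-1 *: (absmx A ^+ n.+1 + absmx (A^t*) ^+ n.+1)).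
Proof.
set S := absmx A ^+ n.+1 + _.
have S0 : psdmx S by apply: psdmxD; apply/psdmx_expr/absmx_psd.
have hS0 : psdmx (2^-1 *: S) by apply: psdmxZ; rewrite ?invr_ge0 ?ler0n.
apply: (@root_unique _ _ d_gt0 _ _ n.+1) => //.
- exact: psdmx_root.
- by apply: psdmxZ; [rewrite rootC_ge0 ?ler0n | exact: psdmx_root].
rewrite exprZmx rootCK // /kato_seq !mxrootK //.
by rewrite scalerA divff ?scale1r ?pnatr_eq0.
Qed.

Lemma kato_seq_ge A n : loewner_le (absmx A) (kato_seq A n.+1) /\
  loewner_le (absmx (A^t*)) (kato_seq A n.+1).
Proof.
rewrite /kato_seq; have := absmx_psd A; have := absmx_psd (A^t*).
move: (absmx A) (absmx (A^t*)) => P Q Q0 P0.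
have S0 := psdmxD (psdmx_expr n.+1 P0) (psdmx_expr n.+1 Q0).
have Sr0 := psdmx_root (ltn0Sn n) S0.
split.
- apply: (root_mono d_gt0 (ltn0Sn n) P0 Sr0); rewrite (mxrootK (ltn0Sn n) S0).
  by rewrite /loewner_le addrC addKr; exact: psdmx_expr.
- apply: (root_mono d_gt0 (ltn0Sn n) Q0 Sr0); rewrite (mxrootK (ltn0Sn n) S0).
  by rewrite /loewner_le addrK; exact: psdmx_expr.
Qed.

End KatoSequence.

(** * Convergence of Kato's sequence to the maximal modulus *)

Section KatoLimit.
Variables (R : realType) (d : nat).
Hypothesis d_gt0 : (0 < d)%N.
Implicit Types A P Q : 'M[R[i]]_d.

(** Each diagonal form is a bounded monotone complex sequence; polarization then expresses every
    entry through convergent diagonal forms. *)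
Lemma cvg_nondecreasing_mx (M : nat -> 'M[R[i]^o]_d) (B : 'M[R[i]]_d) :
  (forall n m, (n <= m)%N -> loewner_le (M n) (M m)) ->
  (forall n, loewner_le (M n) B) -> cvg (M @ \oo).
Proof.
move=> Mmono MB.
have /choice [q qP] : forall x : 'cV[R[i]]_d, exists l : R[i]^o,
    (fun n => sform (M n) x x : R[i]^o) @ \oo --> l.
  move=> x; apply/cvg_ex; apply: (@nondecreasing_cvg_complex _ _ (sform B x x)).
    by move=> n m /Mmono /loewner_leP.
  by move=> n; have /loewner_leP := MB n.
pose l x y : R[i]^o :=
  2^-1 * ((q (x + y) - q x - q y) - 'i * (q (x + 'i *: y) - q x - q y)).
apply/cvg_ex; exists (\matrix_(i, j) l (delta_mx i 0) (delta_mx j 0)).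
apply: mx_cvg => i j; rewrite mxE.
under eq_fun do rewrite -sform_delta sform_polarization.
apply: cvgM; first exact: cvg_cst.
by apply: cvgB; [|apply: cvgM; first exact: cvg_cst];
  apply: cvgB => //; apply: cvgB.
Qed.

(** Since [lim] is informative only for a convergent sequence, this is what makes [maximal_modulus]
    a genuine limit. *)
Lemma kato_seq_cvg A : (kato_seq A : nat -> 'M[R[i]^o]_d) @ \oo -->
  (maximal_modulus A : 'M[R[i]^o]_d).
Proof.
suff [L kL] : exists L : 'M[R[i]^o]_d,
    (kato_seq A : nat -> 'M[R[i]^o]_d) @ \oo --> L.
  by apply/cvg_ex; exists L.
pose M n : 'M[R[i]^o]_d :=
  mxroot n.+1 (2^-1 *: (absmx A ^+ n.+1 + absmx (A^t*) ^+ n.+1)).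
have A0 := absmx_psd A; have A'0 := absmx_psd (A^t*).
have [c Mc] := mean_power_root_bounded d_gt0 A0 A'0.
have /cvg_ex [L ML] : cvg (M @ \oo).
  apply: (@cvg_nondecreasing_mx _ c%:M) => [n m nm|n].
    exact: (@mean_power_root_mono _ _ d_gt0 _ _ n.+1 m.+1 (ltn0Sn n) nm A0 A'0).
  exact: (Mc _ (ltn0Sn n)).
(* The shift discards term 0, whose root has order 0, and keeps the limit. *)
exists L; rewrite -cvg_shiftS; apply: mx_cvg => i j.
rewrite -[L i j]mul1r; under eq_fun do rewrite /= (kato_seqE d_gt0) mxE.
apply: cvgM; last exact: cvg_coord ML.
by apply: cvg_rootC; rewrite ler1n.
Qed.

Lemma maximal_modulus_ge A : loewner_le (absmx A) (maximal_modulus A) /\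
  loewner_le (absmx (A^t*)) (maximal_modulus A).
Proof.
by split; apply: cvg_loewner_ge (@kato_seq_cvg A);
  exists 1%N => // -[//|n] _; case: (kato_seq_ge d_gt0 A n).
Qed.

End KatoLimit.

Theorem corollary3p5 (R : realType) (d m : nat) (hd : (1 <= d)%N)
    (hm : (1 <= m)%N) (A : 'I_m -> 'M[R[i]]_d) :
  exists V : 'M[R[i]]_d, V \is unitarymx /\
    loewner_le (absmx (\sum_(k < m) A k))
      (2^-1 *: \sum_(k < m)
        (maximal_modulus (A k) + V *m maximal_modulus (A k) *m V^t*)).
Proof.
by apply: absmx_sum_le => // k; have [] := maximal_modulus_ge hd (A k).
Qed.
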